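(* Let $\alpha>0$, $f(x)=1-\frac{\alpha}{x}$, and let $(y_i)_{i\in\mathbb{Z}}$ be a sequence of positive reals with $y_n=f(y_{n-1})$ for all $n\in\mathbb{Z}$, such that $y_0+y_l=1$ for some integer $l\ge0$. Then: (1) for every $s\in\mathbb{Z}$, $y_{l+s}+y_{-s}=1$; (2) if $0<\alpha<\frac14$, then $(y_i)_{i\in\mathbb{Z}}$ is strictly increasing and bounded, $r_2<y_i<r_1$ for all $i$, and $\lim_{i\to+\infty}y_i=r_1$; (3) if $0<\alpha<\frac14$, then $y_0$ is the largest real root of the equation $x+F(l,x)=1$, and $y_0=\frac12\big(1-\tanh(\theta)\tanh(\tfrac{l\theta}{2})\big)$.
   Context: For $0<\alpha<\frac14$, $r_2<r_1$ are the two (positive) roots of $\phi(x)=x^2-x+\alpha$, and $\theta=\operatorname{arcosh}\big(\tfrac12\alpha^{-1/2}\big)>0$. For an integer $n$, $F(n,x)=\dfrac{2\cosh(\theta)\sinh((n+1)\theta)x-\sinh(n\theta)}{2\cosh(\theta)\big(2\cosh(\theta)\sinh(n\theta)x-\sinh((n-1)\theta)\big)}$. *)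

(* Defs.v *)
From Stdlib Require Import Reals ZArith Lra.
From Coquelicot Require Import Coquelicot.
Open Scope R_scope.

Definition f_alpha (alpha x : R) : R := 1 - alpha / x.

Definition phi (alpha x : R) : R := x ^ 2 - x + alpha.

(* Principal inverse of cosh, for 1 <= x; same shape as Stdlib's arcsinh. *)
Definition arcosh (x : R) : R := ln (x + sqrt (x ^ 2 - 1)).

Lemma cosh_arcosh (x : R) : 1 <= x -> cosh (arcosh x) = x.
Proof.
  intros Hx.
  assert (Hd : 0 <= x ^ 2 - 1) by nra.
  pose proof (sqrt_pos (x ^ 2 - 1)) as Hs.
  pose proof (sqrt_sqrt _ Hd) as Hss.
  unfold cosh, arcosh. rewrite exp_Ropp, exp_ln by lra.
  set (s := sqrt (x ^ 2 - 1)) in *.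
  replace (/ (x + s)) with (x - s); [lra |].
  apply (Rmult_eq_reg_r (x + s)); [| lra].
  rewrite Rinv_l by lra. nra.
Qed.

Lemma arcosh_nonneg (x : R) : 1 <= x -> 0 <= arcosh x.
Proof.
  intros Hx. pose proof (sqrt_pos (x ^ 2 - 1)) as Hs.
  unfold arcosh. rewrite <- ln_1. apply ln_le; lra.
Qed.

Definition theta (alpha : R) : R := arcosh (1 / 2 * Rpower alpha (- (1 / 2))).

Definition F_num (alpha : R) (n : Z) (x : R) : R :=
  2 * cosh (theta alpha) * sinh (IZR (n + 1) * theta alpha) * x
  - sinh (IZR n * theta alpha).

Definition F_den (alpha : R) (n : Z) (x : R) : R :=
  2 * cosh (theta alpha) *
  (2 * cosh (theta alpha) * sinh (IZR n * theta alpha) * x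
   - sinh (IZR (n - 1) * theta alpha)).

Definition F (alpha : R) (n : Z) (x : R) : R := F_num alpha n x / F_den alpha n x.

(* Division is total, so a root must be required to lie where F is defined. *)
Definition is_root_F (alpha : R) (l : Z) (x : R) : Prop :=
  F_den alpha l x <> 0 /\ x + F alpha l x = 1.

(* Main.v *)
(** Writing the recurrence as [y n * (1 - y (n + 1)) = alpha], the symmetry
    [y (l + s) + y (- s) = 1] propagates from [s] to [s + 1] and back by
    cancelling a positive factor.  With [r1 + r2 = 1] and [r1 * r2 = alpha],
    the ratio [(y n - r2) / (r1 - y n)] is multiplied by [r1 / r2 = exp (2 theta)]
    at each step, which gives the bounds, and since [y l = 1 - y 0] inverts that
    ratio, it equals [exp (- l theta)] at [n = 0].  The equation [x + F l x = 1]
    is quadratic in [x] and splits explicitly over [exp theta] and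
    [exp (l theta)]. *)
Require Import Defs.
From Stdlib Require Import Reals ZArith Lra Lia.
From Coquelicot Require Import Coquelicot.
Open Scope R_scope.

Lemma sequence_symmetric (alpha : R) (y : Z -> R) (l : Z)
  (Hpos : forall n : Z, 0 < y n)
  (Hstep : forall n : Z, y n * (1 - y (n + 1)%Z) = alpha)
  (Hsum : y 0%Z + y l = 1) :
  forall s : Z, y (l + s)%Z + y (- s)%Z = 1.
Proof.
  apply Z.bi_induction.
  - intros s t ->. tauto.
  - rewrite Z.add_0_r. simpl. lra.
  - intros s.
    (* Both products equal [alpha]. The identity at [s], or at [Z.succ s], gives them a common
       factor; cancelling it yields the other identity. *)
    pose proof (Hstep (l + s)%Z) as H1.
    pose proof (Hstep (- Z.succ s)%Z) as H2.
    replace (l + s + 1)%Z with (l + Z.succ s)%Z in H1 by lia.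
    replace (- Z.succ s + 1)%Z with (- s)%Z in H2 by lia.
    pose proof (Hpos (l + s)%Z). pose proof (Hpos (- Z.succ s)%Z).
    split; intros E.
    + apply (Rmult_eq_reg_l (y (l + s)%Z)); [| lra].
      replace (y (- s)%Z) with (1 - y (l + s)%Z) in H2 by lra. lra.
    + apply (Rmult_eq_reg_l (y (- Z.succ s)%Z)); [| lra].
      replace (y (l + Z.succ s)%Z) with (1 - y (- Z.succ s)%Z) in H1 by lra. lra.
Qed.

(** * The sequence relative to the two roots of [phi] *)

Section BetweenRoots.

Variables (alpha r1 r2 : R) (y : Z -> R).
Hypothesis Hpos : forall n : Z, 0 < y n.
Hypothesis Hstep : forall n : Z, y n * (1 - y (n + 1)%Z) = alpha.
Hypothesis Hr2 : 0 < r2.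
Hypothesis Hr21 : r2 < r1.
Hypothesis Hrsum : r1 + r2 = 1.
Hypothesis Hrprod : r1 * r2 = alpha.

(** Vieta's relations make the recurrence linear in the gap. The same factor [y n] occurs in
    [gap_below_step], so it drops out of the ratio of the gaps. *)
Lemma gap_above_step (n : Z) : y n * (r1 - y (n + 1)%Z) = r2 * (r1 - y n).
Proof. pose proof (Hstep n). replace r2 with (1 - r1) in * by lra. lra. Qed.

Lemma gap_below_step (n : Z) : y n * (y (n + 1)%Z - r2) = r1 * (y n - r2).
Proof. pose proof (Hstep n). replace r1 with (1 - r2) in * by lra. lra. Qed.

(** The multipliers [y n] and [r2] are positive, so the gap keeps its sign. *)
Lemma lt_r1_iff (n : Z) : y n < r1 <-> y 0%Z < r1.
Proof.
  revert n. apply Z.bi_induction.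
  - intros i j ->. tauto.
  - tauto.
  - intros n. rewrite <- Z.add_1_r.
    pose proof (gap_above_step n). pose proof (Hpos n).
    enough (y n < r1 <-> y (n + 1)%Z < r1) by tauto.
    split; intros; nra.
Qed.

Lemma gt_r2_iff (n : Z) : r2 < y n <-> r2 < y 0%Z.
Proof.
  revert n. apply Z.bi_induction.
  - intros i j ->. tauto.
  - tauto.
  - intros n. rewrite <- Z.add_1_r.
    pose proof (gap_below_step n). pose proof (Hpos n).
    enough (r2 < y n <-> r2 < y (n + 1)%Z) by tauto.
    split; intros; nra.
Qed.

(** If [y 0 <= r2], then also [y l <= r2], and their sum is below [r1 + r2 = 1]; the upper bound is
    dual. *)
Lemma between_roots (l : Z) (Hsum : y 0%Z + y l = 1) (n : Z) : r2 < y n < r1.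
Proof.
  rewrite lt_r1_iff, gt_r2_iff.
  pose proof (lt_r1_iff l). pose proof (gt_r2_iff l).
  split; apply Rnot_le_lt; intros H1.
  - assert (~ r2 < y l) by (intros H2; apply H0 in H2; lra). lra.
  - assert (~ y l < r1) by (intros H2; apply H in H2; lra). lra.
Qed.

Hypothesis Hbetween : forall n : Z, r2 < y n < r1.

Lemma strictly_increasing (i j : Z) : (i < j)%Z -> y i < y j.
Proof.
  assert (Hsucc : forall n, y n < y (n + 1)%Z).
  { intros n. pose proof (gap_above_step n). pose proof (Hpos n).
    pose proof (Hbetween n). nra. }
  intros Hij. replace j with (i + 1 + Z.of_nat (Z.to_nat (j - i - 1)))%Z by lia.
  induction (Z.to_nat (j - i - 1)) as [|k IH].
  - rewrite Z.add_0_r. apply Hsucc.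
  - rewrite Nat2Z.inj_succ, <- Z.add_1_r, Z.add_assoc.
    eapply Rlt_trans; [apply IH | apply Hsucc].
Qed.

(** Each step scales the gap by [r2 / y m], at most [r2 / y 0] by monotonicity; this ratio is below
    1, which gives the limit. *)
Lemma gap_above_geometric (n : nat) :
  r1 - y (Z.of_nat n) <= (r2 / y 0%Z) ^ n * (r1 - y 0%Z).
Proof.
  induction n as [|n IH]; [simpl; lra|].
  rewrite Nat2Z.inj_succ, <- Z.add_1_r. cbn [pow].
  set (m := Z.of_nat n) in *.
  pose proof (Hpos 0%Z). pose proof (Hpos m). pose proof (Hbetween m).
  assert (H0m : y 0%Z <= y m).
  { destruct (Z.eq_dec 0 m) as [<-|]; [lra|].
    apply Rlt_le, strictly_increasing. lia. }
  replace (r1 - y (m + 1)%Z) with (r2 / y m * (r1 - y m)).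
  2:{ apply (Rmult_eq_reg_l (y m)); [| lra]. rewrite gap_above_step. field. lra. }
  rewrite Rmult_assoc. apply Rmult_le_compat; try lra.
  - apply Rlt_le, Rdiv_lt_0_compat; lra.
  - apply Rmult_le_compat_l; [lra|]. apply Rinv_le_contravar; lra.
Qed.

Lemma limit_r1 : is_lim_seq (fun n : nat => y (Z.of_nat n)) r1.
Proof.
  pose proof (Hpos 0%Z). pose proof (Hbetween 0%Z).
  apply is_lim_seq_le_le with
    (u := fun n => r1 - (r2 / y 0%Z) ^ n * (r1 - y 0%Z)) (w := fun _ => r1).
  - intros n. pose proof (gap_above_geometric n).
    pose proof (Hbetween (Z.of_nat n)). lra.
  - replace (Finite r1) with (Finite (r1 - 0 * (r1 - y 0%Z))) by (f_equal; ring).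
    apply is_lim_seq_minus'; [apply is_lim_seq_const|].
    apply is_lim_seq_mult'; [| apply is_lim_seq_const].
    apply is_lim_seq_geom.
    assert (0 < r2 / y 0%Z) by (apply Rdiv_lt_0_compat; lra).
    rewrite Rabs_pos_eq by lra.
    apply (Rmult_lt_reg_r (y 0%Z)); [lra|].
    unfold Rdiv. rewrite Rmult_assoc, Rinv_l by lra. lra.
  - apply is_lim_seq_const.
Qed.

(** Division-free form of the growth of [(y n - r2) / (r1 - y n)] by [r1 / r2] per step. *)
Lemma gap_ratio_pow (n : nat) :
  r2 ^ n * ((y (Z.of_nat n) - r2) * (r1 - y 0%Z))
  = r1 ^ n * ((r1 - y (Z.of_nat n)) * (y 0%Z - r2)).
Proof.
  induction n as [|n IH]; [simpl; ring|].
  rewrite Nat2Z.inj_succ, <- Z.add_1_r. cbn [pow].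
  set (m := Z.of_nat n) in *. pose proof (Hpos m).
  apply (Rmult_eq_reg_l (y m)); [| lra].
  transitivity (r2 * r2 ^ n * ((y m * (y (m + 1)%Z - r2)) * (r1 - y 0%Z))); [ring|].
  transitivity (r1 * r1 ^ n * ((y m * (r1 - y (m + 1)%Z)) * (y 0%Z - r2))); [| ring].
  rewrite gap_above_step, gap_below_step.
  transitivity (r1 * r2 * (r2 ^ n * ((y m - r2) * (r1 - y 0%Z)))); [ring|].
  rewrite IH. ring.
Qed.

(** Replacing [y n] by [1 - y 0] swaps the two gaps, which leaves an equality of squares; both sides
    are nonnegative, so the square root may be taken. *)
Lemma initial_value (a : R) (n : nat) (Ha : 0 < a) (Hratio : r1 = a ^ 2 * r2)
  (Hsum : y 0%Z + y (Z.of_nat n) = 1) :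
  r1 - y 0%Z = a ^ n * (y 0%Z - r2).
Proof.
  pose proof (gap_ratio_pow n) as H.
  replace (y (Z.of_nat n)) with (1 - y 0%Z) in H by lra.
  replace (r1 ^ n) with (r2 ^ n * (a ^ n * a ^ n)) in H.
  2:{ rewrite Hratio, <- !Rpow_mult_distr. f_equal. ring. }
  replace (1 - y 0%Z - r2) with (r1 - y 0%Z) in H by lra.
  replace (r1 - (1 - y 0%Z)) with (y 0%Z - r2) in H by lra.
  rewrite Rmult_assoc in H.
  apply Rmult_eq_reg_l in H; [| apply pow_nonzero; lra].
  pose proof (Hbetween 0%Z). pose proof (pow_lt a n Ha).
  apply Rsqr_inj; [lra | apply Rmult_le_pos; lra |].
  unfold Rsqr. rewrite H. ring.
Qed.

End BetweenRoots.

(** * Vieta's relations and hyperbolic functions as exponentials *)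

Lemma phi_roots_vieta (alpha r1 r2 : R) (Halpha : 0 < alpha) (Hr : r2 < r1)
  (H1 : phi alpha r1 = 0) (H2 : phi alpha r2 = 0) :
  0 < r2 /\ r1 + r2 = 1 /\ r1 * r2 = alpha.
Proof.
  unfold phi in *.
  assert (Hs : r1 + r2 = 1).
  { apply (Rmult_eq_reg_l (r1 - r2)); [| lra]. lra. }
  assert (r1 * r2 = alpha) by (replace r2 with (1 - r1) by lra; lra).
  repeat split; try assumption. nra.
Qed.

Lemma cosh_theta (alpha : R) (Halpha : 0 < alpha) (Hlt : alpha < 1 / 4) :
  4 * alpha * cosh (theta alpha) ^ 2 = 1 /\ 0 < theta alpha.
Proof.
  set (p := Rpower alpha (- (1 / 2))).
  assert (Hp : 0 < p) by apply exp_pos.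
  assert (Hpp : alpha * (p * p) = 1).
  { unfold p. rewrite <- Rpower_plus.
    replace (- (1 / 2) + - (1 / 2)) with (- (1)) by lra.
    rewrite Rpower_Ropp, Rpower_1 by assumption. field. lra. }
  assert (Hp2 : 1 < 1 / 2 * p).
  { apply Rnot_le_lt. intros Hle. assert (p * p <= 4) by nra. nra. }
  assert (Hc : cosh (theta alpha) = 1 / 2 * p) by (apply cosh_arcosh; fold p; lra).
  split.
  - rewrite Hc. lra.
  (* The value 0 is excluded because [cosh 0 = 1], while [1 / 2 * p] exceeds 1. *)
  - destruct (arcosh_nonneg (1 / 2 * p)) as [H|H]; [lra | exact H |].
    exfalso. unfold theta in Hc. fold p in Hc. rewrite <- H, cosh_0 in Hc. lra.
Qed.

Lemma exp_mult_nat (t : R) (n : nat) : exp (IZR (Z.of_nat n) * t) = exp t ^ n.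
Proof.
  rewrite <- INR_IZR_INZ. induction n as [|n IH].
  - simpl. rewrite Rmult_0_l. apply exp_0.
  - rewrite S_INR, Rmult_plus_distr_r, exp_plus, IH, Rmult_1_l. simpl. ring.
Qed.

Lemma tanh_exp (t : R) : tanh t = (exp t ^ 2 - 1) / (exp t ^ 2 + 1).
Proof.
  unfold tanh, sinh, cosh. rewrite exp_Ropp.
  pose proof (exp_pos t). field. nra.
Qed.

(** * The equation [x + F alpha l x = 1] *)

Section RootsOfF.

Variables (alpha : R) (l : Z).
Let a := exp (theta alpha).
Let E := exp (IZR l * theta alpha).
Hypothesis Ha : 1 < a.
Hypothesis HE : 1 <= E.

Lemma cosh_theta_exp : cosh (theta alpha) = (a + / a) / 2.
Proof. unfold cosh, a. rewrite exp_Ropp. reflexivity. Qed.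

Lemma sinh_l_exp : sinh (IZR l * theta alpha) = (E - / E) / 2.
Proof. unfold sinh, E. rewrite exp_Ropp. reflexivity. Qed.

Lemma sinh_succ_exp : sinh (IZR (l + 1) * theta alpha) = (E * a - / (E * a)) / 2.
Proof.
  unfold sinh, E, a. rewrite exp_Ropp, plus_IZR, Rmult_plus_distr_r, exp_plus, Rmult_1_l.
  reflexivity.
Qed.

Lemma sinh_pred_exp : sinh (IZR (l - 1) * theta alpha) = (E / a - a / E) / 2.
Proof.
  unfold sinh. rewrite exp_Ropp, minus_IZR.
  replace ((IZR l - 1) * theta alpha) with (IZR l * theta alpha + - theta alpha) by ring.
  rewrite exp_plus, exp_Ropp. fold E a. field. split; lra.
Qed.

(** Here [t] is [tanh (theta alpha)]. With every hyperbolic function written through [a] and [E],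
    this is an identity of rational functions. *)
Lemma F_equation_factors (x : R) :
  let t := (a ^ 2 - 1) / (a ^ 2 + 1) in
  (1 - x) * F_den alpha l x - F_num alpha l x =
  - ((a + / a) / 2) ^ 2 / (2 * E) *
  (((E + 1) * (2 * x - 1) + t * (E - 1)) * ((E - 1) * (2 * x - 1) + t * (E + 1))).
Proof.
  unfold F_den, F_num.
  rewrite cosh_theta_exp, sinh_l_exp, sinh_succ_exp, sinh_pred_exp.
  field. repeat split; nra.
Qed.

(** Ensures that [F] is defined at the claimed root. The bracket is affine in [x] with nonnegative
    slope, and positive at [/ (a ^ 2 + 1)], the smaller root of [phi]. *)
Lemma F_den_pos (x : R) : / (a ^ 2 + 1) < x -> 0 < F_den alpha l x.
Proof.
  intros Hx. unfold F_den. rewrite cosh_theta_exp, sinh_l_exp, sinh_pred_exp.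
  assert (Hia : 0 < / a) by (apply Rinv_0_lt_compat; lra).
  assert (HiE : 0 < / E) by (apply Rinv_0_lt_compat; lra).
  assert (/ E <= 1) by (rewrite <- Rinv_1; apply Rinv_le_contravar; lra).
  apply Rmult_lt_0_compat; [lra|].
  replace (2 * ((a + / a) / 2) * ((E - / E) / 2) * x - (E / a - a / E) / 2)
    with ((a + / a) * ((E - / E) / 2) * (x - / (a ^ 2 + 1))
          + (a ^ 2 - 1) / a * / E / 2) by (field; repeat split; nra).
  apply Rplus_le_lt_0_compat.
  - apply Rmult_le_pos; [| lra]. apply Rmult_le_pos; lra.
  - apply Rmult_lt_0_compat; [| lra]. apply Rmult_lt_0_compat; [| lra].
    apply Rdiv_lt_0_compat; nra.
Qed.

(* The two factors vanish at [2 x - 1 = - t (E - 1) / (E + 1)] and, when [1 < E],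
   at the smaller [2 x - 1 = - t (E + 1) / (E - 1)]. *)
Lemma largest_root_F (x0 : R) :
  / (a ^ 2 + 1) < x0 ->
  a ^ 2 / (a ^ 2 + 1) - x0 = E * (x0 - / (a ^ 2 + 1)) ->
  is_root_F alpha l x0 /\ (forall x : R, is_root_F alpha l x -> x <= x0).
Proof.
  intros Hlow Hx0.
  set (t := (a ^ 2 - 1) / (a ^ 2 + 1)).
  assert (Ht : 0 < t) by (apply Rdiv_lt_0_compat; nra).
  assert (H0 : (E + 1) * (2 * x0 - 1) + t * (E - 1) = 0).
  { replace (a ^ 2 / (a ^ 2 + 1)) with ((1 + t) / 2) in Hx0 by (unfold t; field; nra).
    replace (/ (a ^ 2 + 1)) with ((1 - t) / 2) in Hx0 by (unfold t; field; nra).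
    lra. }
  split.
  - pose proof (F_den_pos x0 Hlow) as Hden. split; [lra|].
    pose proof (F_equation_factors x0) as Hq. cbv zeta in Hq. fold t in Hq.
    rewrite H0, Rmult_0_l, Rmult_0_r in Hq.
    unfold F. replace (F_num alpha l x0) with ((1 - x0) * F_den alpha l x0) by lra.
    field. lra.
  - intros x [Hden Hx].
    assert (Hnum : (1 - x) * F_den alpha l x - F_num alpha l x = 0).
    { replace (1 - x) with (F alpha l x) by lra. unfold F. field. exact Hden. }
    rewrite F_equation_factors in Hnum. fold t in Hnum.
    apply Rmult_integral in Hnum. destruct Hnum as [Hc | Hnum].
    + exfalso. revert Hc.
      assert (0 < / a) by (apply Rinv_0_lt_compat; lra).
      assert (0 < ((a + / a) / 2) ^ 2 / (2 * E))
        by (apply Rdiv_lt_0_compat; [apply pow_lt|]; lra).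
      unfold Rdiv in *. rewrite Ropp_mult_distr_l_reverse. lra.
    + apply Rnot_lt_le. intros Hlt.
      apply Rmult_integral in Hnum. destruct Hnum as [Hf | Hf]; [nra|].
      (* Scaling [Hf] by [E + 1] and [H0] by [E - 1] and subtracting avoids dividing by [E - 1], so
         [E = 1] is covered. *)
      assert (2 * ((E ^ 2 - 1) * (x - x0)) = - (4 * (t * E))) by nra.
      assert (0 <= (E ^ 2 - 1) * (x - x0)) by (apply Rmult_le_pos; nra).
      assert (0 < t * E) by (apply Rmult_lt_0_compat; lra).
      lra.
Qed.

End RootsOfF.

Theorem theorem3p1 (alpha : R) (y : Z -> R) (l : Z)
  (Halpha : 0 < alpha)
  (Hpos : forall n : Z, 0 < y n)
  (Hrec : forall n : Z, y n = f_alpha alpha (y (n - 1)%Z))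
  (Hl : (0 <= l)%Z)
  (Hsum : y 0%Z + y l = 1) :
  (forall s : Z, y (l + s)%Z + y (- s)%Z = 1)
  /\
  (alpha < 1 / 4 ->
   (forall i j : Z, (i < j)%Z -> y i < y j)
   /\ (exists M : R, forall i : Z, Rabs (y i) <= M)
   /\ (forall r1 r2 : R, r2 < r1 -> phi alpha r1 = 0 -> phi alpha r2 = 0 ->
         (forall i : Z, r2 < y i < r1)
         /\ is_lim_seq (fun n : nat => y (Z.of_nat n)) r1))
  /\
  (alpha < 1 / 4 ->
   (is_root_F alpha l (y 0%Z)
    /\ (forall x : R, is_root_F alpha l x -> x <= y 0%Z))
   /\ y 0%Z =
      1 / 2 * (1 - tanh (theta alpha) * tanh (IZR l * theta alpha / 2))).
Proof.
  assert (Hstep : forall n : Z, y n * (1 - y (n + 1)%Z) = alpha).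
  { intros n. rewrite (Hrec (n + 1)%Z), Z.add_simpl_r.
    unfold f_alpha. field. apply Rgt_not_eq, Hpos. }
  split; [exact (sequence_symmetric alpha y l Hpos Hstep Hsum)|].
  match goal with |- (?P -> ?Q) /\ (_ -> ?S) => enough (P -> Q /\ S) by tauto end.
  intros Hlt.
  destruct (cosh_theta alpha Halpha Hlt) as [Hcosh Htheta].
  set (a := exp (theta alpha)).
  assert (Ha : 1 < a) by (unfold a; rewrite <- exp_0; apply exp_increasing, Htheta).
  set (r1 := a ^ 2 / (a ^ 2 + 1)). set (r2 := / (a ^ 2 + 1)).
  assert (Hr2 : 0 < r2) by (apply Rinv_0_lt_compat; nra).
  assert (Hratio : r1 = a ^ 2 * r2) by reflexivity.
  assert (Hr21 : r2 < r1) by (rewrite Hratio; assert (1 < a ^ 2) by nra; nra).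
  assert (Hrsum : r1 + r2 = 1) by (unfold r1, r2; field; nra).
  assert (Hrprod : r1 * r2 = alpha).
  (* Both [r1 * r2] and [alpha] are the inverse of [4 * cosh (theta alpha) ^ 2]. *)
  { rewrite cosh_theta_exp in Hcosh. fold a in Hcosh.
    apply (Rmult_eq_reg_r (4 * ((a + / a) / 2) ^ 2)).
    - transitivity 1; [| lra]. unfold r1, r2. field. split; nra.
    - intros H0. apply (Rmult_eq_compat_l alpha) in H0. lra. }
  pose proof (between_roots alpha r1 r2 y Hpos Hstep Hr2 Hr21 Hrsum Hrprod l Hsum)
    as Hbetween.
  split; [split; [|split]|].
  - eapply strictly_increasing; eassumption.
  - exists r1. intros i. specialize (Hbetween i). rewrite Rabs_pos_eq; lra.
  - intros s1 s2 Hs H1 H2.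
    (* The bounds are rederived for the given roots, with no need to identify them with [r1] and
       [r2]. *)
    destruct (phi_roots_vieta alpha s1 s2 Halpha Hs H1 H2) as (Hs2 & Hss & Hsp).
    pose proof (between_roots alpha s1 s2 y Hpos Hstep Hs2 Hs Hss Hsp l Hsum) as Hb.
    split; [exact Hb|].
    eapply limit_r1; eassumption.
  - assert (Hinit : r1 - y 0%Z = exp (IZR l * theta alpha) * (y 0%Z - r2)).
    { rewrite <- (Z2Nat.id l Hl) in Hsum |- *. rewrite exp_mult_nat. fold a.
      eapply initial_value; try eassumption; lra. }
    assert (HE : 1 <= exp (IZR l * theta alpha)).
    { pose proof (exp_ineq1_le (IZR l * theta alpha)).
      assert (0 <= IZR l * theta alpha)
        by (apply Rmult_le_pos; [apply IZR_le, Hl | lra]).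
      lra. }
    split.
    + apply largest_root_F; try assumption. apply Hbetween.
    + rewrite !tanh_exp. fold a.
      replace (exp (IZR l * theta alpha / 2) ^ 2) with (exp (IZR l * theta alpha)).
      2:{ simpl. rewrite Rmult_1_r, <- exp_plus. f_equal. field. }
      set (E := exp (IZR l * theta alpha)) in *.
      (* [Hinit] solved for [y 0] reads [(E + 1) * y 0 = r1 + E * r2]. *)
      apply (Rmult_eq_reg_l (E + 1)); [| lra].
      transitivity (r1 + E * r2); [lra|].
      unfold r1, r2. field. split; nra.
Qed.
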